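(* Let $R$ be a maximal subring of a ring $T$. If $T/R$, as a right $R$-module, has a maximal submodule, then $(R:T)_l$ is a right primitive ideal of $R$. In particular, if $T/R$ (equivalently $T_R$) is a finitely generated right $R$-module, then $(R:T)_l$ is a right primitive ideal of $R$.
   Context: All rings are associative, unital with $1\neq 0$, and not necessarily commutative; subrings contain the identity of the overring; modules are unital. A subring $R\subsetneq T$ is a maximal subring of $T$ if there is no subring $S$ with $R\subsetneq S\subsetneq T$. $(R:T)_l:=\{x\in T\mid Tx\subseteq R\}$ is the largest left ideal of $T$ contained in $R$; it is a two-sided ideal of $R$. A right primitive ideal is the annihilator of a simple right module. *)

(* Defs.v *)
From HB Require Import structures.
Set Warnings "-notation-overridden,-ambiguous-paths,-redundant-canonical-projection".
From mathcomp Require Import all_boot all_algebra.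
From mathcomp Require Import boolp classical_sets.

Set Implicit Arguments.
Unset Strict Implicit.
Unset Printing Implicit Defensive.

Import GRing.Theory.

Local Open Scope quotient_scope.
Local Open Scope ring_scope.
Local Open Scope classical_set_scope.

(* Right modules over A are left modules over the converse ring A^c:
   for M : rmodType A, (a : A^c) *: m is what is usually written m a. *)
Notation rmodType A := (lmodType A^c).

Definition psub (X : Type) (P Q : {pred X}) : Prop :=
  {subset P <= Q} /\ exists2 x, x \in Q & x \notin P.

Section Modules.
Variables (A : nzRingType) (M : lmodType A).

Definition is_maximal_submodule (N : submodClosed M) : Prop :=
  psub N predT /\ ~ exists N' : submodClosed M, psub N N' /\ psub N' predT.

Definition has_maximal_submodule : Prop :=
  exists N : submodClosed M, is_maximal_submodule N.

Definition is_simple_module : Prop :=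
  (exists m : M, m != 0) /\
  forall N : submodClosed M, N =i pred1 0 \/ N =i predT.

Definition finitely_generated : Prop :=
  exists (n : nat) (e : 'I_n -> M), forall m : M,
  exists c : 'I_n -> A, m = \sum_(i < n) c i *: e i.

Definition annihilator : set A := [set a | forall m : M, a *: m = 0].

End Modules.

Arguments has_maximal_submodule {A} M.
Arguments is_simple_module {A} M.
Arguments finitely_generated {A} M.
Arguments annihilator {A} M.

Definition is_right_primitive (A : nzRingType) (P : set A) : Prop :=
  exists2 M : rmodType A, is_simple_module M & P = annihilator M.

Section QuotientModule.
Variables (A : nzRingType) (M : lmodType A) (N : submodClosed M).

(* submodClosed does not record closure under opposites, which the library's
   quotient of additive groups needs; over a ring it follows from scaling
   by -1. *)
Definition submod_pred : {pred M} := N.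

Fact submod_pred_zmod_closed : zmod_closed submod_pred.
Proof.
split=> [|x y Nx Ny]; first exact: (rpred0 N).
have Nz : -1 *: y \in N by apply: rpredZ.
by rewrite -scaleN1r; apply: (@rpredD _ N).
Qed.

HB.instance Definition _ :=
  GRing.isZmodClosed.Build M submod_pred submod_pred_zmod_closed.

Definition quot_module : Type := Quotient.quot submod_pred.

HB.instance Definition _ := GRing.Zmodule.on quot_module.
HB.instance Definition _ : EqQuotient M (Quotient.equiv submod_pred) quot_module :=
  EqQuotient.on quot_module.

Definition quot_scale (a : A) (q : quot_module) : quot_module :=
  \pi_quot_module (a *: repr q).

Fact quot_module_eq (x y : M) :
  (\pi_quot_module x == \pi_quot_module y) = (x - y \in N).
Proof. exact/esym/(Quotient.idealrBE submod_pred). Qed.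

Fact quot_scale_pi a x :
  quot_scale a (\pi_quot_module x) = \pi_quot_module (a *: x).
Proof.
apply/eqP; rewrite quot_module_eq -scalerBr; apply: rpredZ.
by rewrite -quot_module_eq reprK.
Qed.

Fact quot_piD x y :
  \pi_quot_module (x + y) = \pi_quot_module x + \pi_quot_module y.
Proof. exact (@Quotient.pi_add M submod_pred x y). Qed.

Fact quot_scaleA a b q : quot_scale a (quot_scale b q) = quot_scale (a * b) q.
Proof.
by elim/quotW: q => x; rewrite (quot_scale_pi b x) !quot_scale_pi scalerA.
Qed.

Fact quot_scale1 : left_id 1 quot_scale.
Proof. by elim/quotW=> x; rewrite quot_scale_pi scale1r. Qed.

Fact quot_scaleDr : right_distributive quot_scale +%R.
Proof.
move=> a; elim/quotW=> x; elim/quotW=> y.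
by rewrite -quot_piD !quot_scale_pi scalerDr quot_piD.
Qed.

Fact quot_scaleDl q : {morph quot_scale^~ q : a b / a + b}.
Proof.
by move=> a b; elim/quotW: q => x; rewrite !quot_scale_pi scalerDl quot_piD.
Qed.

HB.instance Definition _ := GRing.Zmodule_isLmodule.Build A quot_module
  quot_scaleA quot_scale1 quot_scaleDr quot_scaleDl.

End QuotientModule.

(* T_R: the additive group T on which R acts by right multiplication. The
   unused argument R selects the module structure. *)
Definition over_subring (T : nzRingType) (R : subringClosed T) : Type := T.

Section Subring.
Variables (T : nzRingType) (R : subringClosed T).

Definition is_maximal_subring : Prop :=
  psub R predT /\ ~ exists S : subringClosed T, psub R S /\ psub S predT.

Definition subring : Type := {x : T | x \in R}.

HB.instance Definition _ := SubChoice.on subring.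
HB.instance Definition _ := [SubChoice_isSubNzRing of subring by <:].

HB.instance Definition _ := GRing.Zmodule.on (over_subring R).

Definition right_scale (r : subring^c) (x : over_subring R) : over_subring R :=
  (x : T) * val (r : subring).

Fact right_scaleA a b x :
  right_scale a (right_scale b x) = right_scale (a * b) x.
Proof. by rewrite /right_scale -mulrA -rmorphM. Qed.

Fact right_scale1 : left_id 1 right_scale.
Proof. by move=> x; rewrite /right_scale rmorph1 mulr1. Qed.

Fact right_scaleDr : right_distributive right_scale +%R.
Proof. by move=> a x y; rewrite /right_scale mulrDl. Qed.

Fact right_scaleDl x : {morph right_scale^~ x : a b / a + b}.
Proof. by move=> a b; rewrite /right_scale rmorphD mulrDr. Qed.

HB.instance Definition _ := GRing.Zmodule_isLmodule.Build subring^c (over_subring R)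
  right_scaleA right_scale1 right_scaleDr right_scaleDl.

(* R itself, as a right R-submodule of T_R. *)
Definition subring_submod : {pred over_subring R} := R.

Fact subring_submod_closed : subsemimod_closed subring_submod.
Proof.
split; first by split=> [|x y Rx Ry]; [exact: (rpred0 R)|exact: (rpredD Rx Ry)].
move=> r x Rx.
exact: (@rpredM T R x (val (r : subring)) Rx (valP (r : subring))).
Qed.

HB.instance Definition _ := GRing.isSubmodClosed.Build subring^c (over_subring R)
  subring_submod subring_submod_closed.

(* The right R-module T/R. *)
Definition overring_quotient : rmodType subring := quot_module subring_submod.

(* (R : T)_l, as a subset of T. *)
Definition left_conductor : set T := [set x | forall t : T, t * x \in R].

End Subring.

Arguments subring_submod {T} R.
Arguments overring_quotient {T} R.
Arguments left_conductor {T} R.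

(* Main.v *)
Require Import Defs.
From HB Require Import structures.
From mathcomp Require Import all_boot all_algebra.
From mathcomp Require Import boolp classical_sets.

(** Let N be a maximal submodule of T/R and let I be the set of those x in T
    with T x sent into N by the projection from T onto T/R. Then I is a left
    ideal of T stable under right multiplication by R, so R + I is a subring
    of T. The image of R + I in T/R lies in N, which is proper; hence R + I is
    not T, and maximality of R forces I to be contained in R. As I is a left
    ideal of T, it lies in (R : T)_l, and the reverse inclusion is clear
    ([left_conductor_proper_submodule]). But I is, inside R, the annihilator
    of (T/R)/N, which is simple ([simple_quot_module]).

    If T/R is finitely generated, then T_R is generated by 1 together with
    lifts of generators of T/R; moreover the nonzero module T/R then has a
    maximal submodule, by Zorn's lemma
    ([finitely_generated_has_maximal_submodule]). *)

Set Implicit Arguments.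
Unset Strict Implicit.
Unset Printing Implicit Defensive.

Import GRing.Theory.

Local Open Scope quotient_scope.
Local Open Scope ring_scope.
Local Open Scope classical_set_scope.

Lemma submodClosed_of_prop (A : nzRingType) (M : lmodType A) (P : M -> Prop) :
    P 0 -> (forall a x y, P x -> P y -> P (a *: x + y)) ->
  exists N : submodClosed M, forall x, x \in N <-> P x.
Proof.
move=> P0 Plin; pose S : {pred M} := fun x => `[< P x >].
have inS x : x \in S <-> P x by split=> /asboolP.
have Scl : subsemimod_closed S.
  split; first split; first exact/inS.
  - by move=> x y /inS Px /inS Py; apply/inS; rewrite -[x]scale1r; apply: Plin.
  - by move=> a x /inS Px; apply/inS; rewrite -[_ *: _]addr0; apply: Plin.
pose Sm := GRing.isSubmodClosed.Build A M S Scl.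
by exists (HB.pack_for (submodClosed M) S Sm).
Qed.

Lemma subringClosed_of_prop (T : nzRingType) (P : T -> Prop) :
    P 1 -> (forall x y, P x -> P y -> P (x - y)) ->
    (forall x y, P x -> P y -> P (x * y)) ->
  exists S : subringClosed T, forall x, x \in S <-> P x.
Proof.
move=> P1 PB PM; pose S : {pred T} := fun x => `[< P x >].
have inS x : x \in S <-> P x by split=> /asboolP.
have Scl : subring_closed S.
  split; first exact/inS.
  - by move=> x y /inS Px /inS Py; apply/inS/PB.
  - by move=> x y /inS Px /inS Py; apply/inS/PM.
pose Sm := GRing.isSubringClosed.Build T S Scl.
by exists (HB.pack_for (subringClosed T) S Sm).
Qed.

Section Quotients.
Variables (A : nzRingType) (M : lmodType A) (N : submodClosed M).

Lemma quot_module_eq0 (x : M) :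
  (\pi_(quot_module N) x == 0 :> quot_module N) = (x \in N).
Proof.
have -> : 0 = \pi_(quot_module N) 0 :> quot_module N.
  apply: (@addrI _ (\pi_(quot_module N) 0)).
  by rewrite -quot_piD !addr0.
by rewrite quot_module_eq subr0.
Qed.

Lemma quot_piZ a (x : M) :
  \pi_(quot_module N) (a *: x) = a *: (\pi_(quot_module N) x : quot_module N).
Proof. by rewrite -quot_scale_pi. Qed.

Lemma quot_pi_sum n (F : 'I_n -> M) :
  \pi_(quot_module N) (\sum_i F i) =
  \sum_i (\pi_(quot_module N) (F i) : quot_module N).
Proof.
elim: n F => [|n IHn] F.
  by rewrite !big_ord0; apply/eqP; rewrite quot_module_eq0 rpred0.
by rewrite !big_ord_recl quot_piD IHn.
Qed.

Lemma simple_quot_module :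
  is_maximal_submodule N -> is_simple_module (quot_module N).
Proof.
move=> [[_ [x _ xN]] maxN]; split.
  by exists (\pi_(quot_module N) x); rewrite quot_module_eq0.
move=> K.
have [N' inN'] : exists N' : submodClosed M,
    forall y, y \in N' <-> \pi_(quot_module N) y \in K.
  apply: submodClosed_of_prop => [|a y z Ky Kz].
    suff -> : \pi_(quot_module N) 0 = 0 by rewrite rpred0.
    by apply/eqP; rewrite quot_module_eq0 rpred0.
  by rewrite quot_piD quot_piZ; apply: rpredD => //; apply: rpredZ.
have sNN' : {subset N <= N'}.
  by move=> y; rewrite -quot_module_eq0 => /eqP y0; apply/inN'; rewrite y0 rpred0.
have [[y yN' yN]|noN'] := pselect (exists2 y, y \in N' & y \notin N).
- right; elim/quotW=> z; rewrite inE; apply/inN'/negPn/negP=> zN'.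
  by apply: maxN; exists N'; split; split=> //; [exists y|exists z].
- left; elim/quotW=> z; rewrite inE quot_module_eq0.
  apply/idP/idP=> [/inN' zN'|/sNN'/inN'//].
  by apply/negPn/negP=> zN; apply: noN'; exists z.
Qed.

End Quotients.

(** A set of vectors stable under a *: x + y: a submodule, or the empty set.
    Admitting the empty set makes the union of an empty chain harmless. *)
Definition linear_set (A : nzRingType) (M : lmodType A) (X : set M) :=
  forall a x y, X x -> X y -> X (a *: x + y).

Lemma total_on_seq (T : eqType) (F : set (set T)) (s : seq T) :
    total_on F subset -> F !=set0 ->
    {in s, forall x, (\bigcup_(X in F) X) x} ->
  exists2 X, F X & {in s, forall x, X x}.
Proof.
move=> totF [X0 FX0]; elim: s => [|x s IHs] Fs; first by exists X0.
have [|X FX Xs] := IHs; first by move=> y ys; apply: Fs; rewrite inE ys orbT.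
have [Y FY Yx] := Fs x (mem_head x s).
have [sXY|sYX] := totF _ _ FX FY.
  by exists Y => // y /predU1P[->//|/Xs/sXY].
by exists X => // y /predU1P[->|/Xs//]; apply: sYX.
Qed.

Lemma finitely_generated_has_maximal_submodule
    (A : nzRingType) (M : lmodType A) (m : M) :
  m != 0 -> finitely_generated M -> has_maximal_submodule M.
Proof.
move=> m0 [n [e gen_e]].
pose P (X : set M) := linear_set X /\ exists x, ~ X x.
have [|X [[Xlin [x Xx]] maxX]] := @Zorn_bigcup M P.
  move=> F FP totF; split.
    move=> a x y [X FX Xx] [Y FY Yy].
    have [sXY|sYX] := totF _ _ FX FY.
    - by exists Y => //; apply: (FP Y FY).1 => //; apply: sXY.
    - by exists X => //; apply: (FP X FX).1 => //; apply: sYX.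
  apply: contrapT => /forallNP allF; have {}allF x := contrapT (allF x).
  have F0 : F !=set0 by have [X FX _] := allF 0; exists X.
  have [|X FX Xe] := @total_on_seq _ F (0 :: codom e) totF F0.
    by move=> y _; apply: allF.
  have [Xlin [x]] := FP X FX; apply.
  have [c ->] := gen_e x.
  (* A member of the chain containing 0 and all generators would be M. *)
  apply: (big_ind X) => [|y z Xy Xz|i _].
  - by apply: Xe; rewrite mem_head.
  - by rewrite -[y]scale1r; apply: Xlin.
  - rewrite -[_ *: _]addr0; apply: Xlin; apply: Xe; last exact: mem_head.
    by rewrite inE codom_f orbT.
have X0 : X 0.
  have [[y Xy]|Xempty] := pselect (X !=set0).
    by rewrite -(subrr y) -scaleN1r addrC; apply: Xlin.
  (* A maximal member cannot be empty, since 0 is a proper submodule of M. *)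
  exfalso; apply: (maxX [set 0]).
    split=> [y Xy|/(_ 0 erefl) Xz]; first by case: Xempty; exists y.
    by apply: Xempty; exists 0.
  split=> [a y z /= -> ->|]; first by rewrite scaler0 addr0.
  by exists m => /= /eqP; apply/negP.
have [N inN] := submodClosed_of_prop X0 Xlin.
exists N; split; first by split=> //; exists x => //; apply/negP=> /inN.
move=> [N' [[sNN' [y yN' yN]] [_ [z _ zN']]]].
apply: (maxX [set` N']).
  split=> [u /inN/sNN'//|sN'X]; apply/(negP yN)/inN; exact: sN'X.
split=> [a u v /= uN' vN'|]; last by exists z; apply/negP.
by apply: rpredD => //; apply: rpredZ.
Qed.

Section MaximalSubring.
Variables (T : nzRingType) (R : subringClosed T).

(** The projection from T onto T/R. *)
Definition overring_proj (x : T) : overring_quotient R :=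
  \pi_(quot_module (subring_submod R)) x.

Local Notation pi := overring_proj.

Lemma overring_proj_eq0 x : (pi x == 0) = (x \in R).
Proof. exact: quot_module_eq0. Qed.

Lemma overring_projD x y : pi (x + y) = pi x + pi y.
Proof. exact: quot_piD. Qed.

Lemma overring_projZ (r : subring R) x :
  pi (x * val r) = (r : (subring R)^c) *: pi x.
Proof. by rewrite /overring_proj -quot_piZ. Qed.

Lemma overring_proj_surj q : exists x, q = pi x.
Proof. by exists (repr q); rewrite /overring_proj reprK. Qed.

Lemma overring_proj_sum n (F : 'I_n -> over_subring R) :
  pi (\sum_i F i) = \sum_i pi (F i).
Proof. exact: quot_pi_sum. Qed.

Lemma finitely_generated_overring_quotient :
  finitely_generated (overring_quotient R) <->
  finitely_generated (over_subring R : rmodType (subring R)).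
Proof.
split=> [[n [e gen_e]]|[n [e gen_e]]].
  have [f ef] := choice (fun i => overring_proj_surj (e i)).
  (* Generator 0 is 1; the others lift the generators of T/R. The coefficient
     of 1 is the defect t - t' of the lifted combination, which lies in R. *)
  exists n.+1, (fun i => if unlift ord0 i is Some j then f j
                         else (1 : T) : over_subring R).
  move=> t; have [c pit] := gen_e (pi t).
  pose t' : over_subring R := \sum_i c i *: (f i : over_subring R).
  have Rt : (t - t' : T) \in R.
    rewrite -overring_proj_eq0.
    have pit' : pi t = pi t'.
      rewrite pit overring_proj_sum; apply: eq_bigr => i _.
      by rewrite ef -overring_projZ.
    by apply/eqP/(addIr (pi t')); rewrite -overring_projD subrK add0r.
  exists (fun i => if unlift ord0 i is Some j then c j
                   else (Sub (t - t' : T) Rt : subring R)).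
  rewrite big_ord_recl unlift_none.
  under eq_bigr do rewrite liftK.
  have -> : (Sub (t - t' : T) Rt : (subring R)^c) *: ((1 : T) : over_subring R)
      = t - t' by rewrite -[LHS]/(1 * (t - t' : T)) mul1r.
  by rewrite -/t' subrK.
exists n, (fun i => pi (e i)) => q; have [t ->] := overring_proj_surj q.
have [c ->] := gen_e t; exists c.
by rewrite overring_proj_sum; apply: eq_bigr => i _; rewrite -overring_projZ.
Qed.

Hypothesis maxR : is_maximal_subring R.

(** The set I of those x with T x sent into N is a left ideal of T with
    I R contained in I, so R + I is a subring; it is proper because N is, hence
    equal to R by maximality of R. *)
Lemma left_conductor_proper_submodule (N : submodClosed (overring_quotient R)) :
    psub N predT ->
  left_conductor R = [set x : T | forall t : T, pi (t * x) \in N].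
Proof.
move=> [_ [q _ qN]].
pose I : set T := [set x | forall t : T, pi (t * x) \in N].
have RN r : r \in R -> pi r \in N.
  by rewrite -overring_proj_eq0 => /eqP->; apply: rpred0.
have IB x y : I x -> I y -> I (x - y).
  move=> Ix Iy t; rewrite mulrBr overring_projD.
  apply: rpredD => //.
  by rewrite -mulrN -mulN1r mulrA; apply: Iy.
have IZ t x : I x -> I (t * x) by move=> Ix u; rewrite mulrA; apply: Ix.
have IR x r : I x -> r \in R -> I (x * r).
  move=> Ix Rr t; rewrite mulrA.
  rewrite -[r]/(val (Sub r Rr : subring R)) overring_projZ.
  by apply: rpredZ; apply: Ix.
have I0 : I 0 by move=> t; rewrite mulr0; apply/RN/rpred0.
have [S inS] : exists S : subringClosed T,
    forall x, x \in S <-> exists2 r, r \in R & I (x - r).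
  apply: subringClosed_of_prop.
  - by exists 1; rewrite ?rpred1 ?subrr.
  - move=> x y [r Rr Ixr] [s Rs Iys]; exists (r - s); first exact: rpredB.
    have -> : x - y - (r - s) = (x - r) - (y - s).
      by rewrite !opprB addrACA [RHS]addrACA [- y - r]addrC.
    exact: IB.
  - move=> x y [r Rr Ixr] [s Rs Iys]; exists (r * s); first exact: rpredM.
    have -> : x * y - r * s = x * (y - s) - - ((x - r) * s).
      by rewrite opprK mulrBr mulrBl addrA subrK.
    apply: (IB _ _); first exact: IZ.
    by rewrite -[- _]sub0r; apply: IB => //; apply: IR.
have sRS : {subset R <= S}.
  by move=> x Rx; apply/inS; exists x; rewrite ?subrr.
have [t tS] : exists t, t \notin S.
  have [t qt] := overring_proj_surj q; move: qN; rewrite qt => tN.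
  exists t; apply: contra tN => /inS[r Rr /(_ 1)].
  rewrite mul1r => Itr; rewrite -[t](subrK r) overring_projD.
  by apply: rpredD => //; apply: RN.
have sIR x : I x -> x \in R.
  move=> Ix; apply: contrapT => /negP xR; apply: maxR.2; exists S.
  split; split=> //; last by exists t.
  by exists x => //; apply/inS; exists 0; rewrite ?rpred0 ?subr0.
rewrite -/I; apply/seteqP; split=> x /= xP.
  by move=> u; apply: RN.
by move=> u; apply/sIR/IZ.
Qed.

Lemma left_conductor_right_primitive :
  has_maximal_submodule (overring_quotient R) ->
  is_right_primitive ((val : subring R -> T) @^-1` left_conductor R).
Proof.
move=> [N maxN]; exists (quot_module N); first exact: simple_quot_module.
rewrite (left_conductor_proper_submodule maxN.1).
apply/seteqP; split=> r /= rP.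
  elim/quotW=> q; have [t ->] := overring_proj_surj q.
  by rewrite -quot_piZ -overring_projZ; apply/eqP; rewrite quot_module_eq0.
move=> t; rewrite overring_projZ -quot_module_eq0 quot_piZ.
by apply/eqP/rP.
Qed.

End MaximalSubring.

Theorem corollary2p5 (T : nzRingType) (R : subringClosed T)
    (maxR : is_maximal_subring R) :
  (has_maximal_submodule (overring_quotient R) ->
     is_right_primitive ((val : subring R -> T) @^-1` left_conductor R)) /\
  (finitely_generated (overring_quotient R) <->
     finitely_generated (over_subring R : rmodType (subring R))) /\
  (finitely_generated (overring_quotient R) ->
     is_right_primitive ((val : subring R -> T) @^-1` left_conductor R)).
Proof.
split; first exact: left_conductor_right_primitive.
split=> [|fgQ]; first exact: finitely_generated_overring_quotient.
apply: left_conductor_right_primitive => //.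
have [[_ [x _ xR]] _] := maxR.
have q0 : overring_proj R x != 0 by rewrite overring_proj_eq0.
exact: finitely_generated_has_maximal_submodule q0 fgQ.
Qed.
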